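(* Let $(X,\preccurlyeq,s)$ be a Maximum Common Subelement (MCS) Model and define, for $x_1,x_2\in X$, $$d_a(x_1,x_2)=s(x_1)+s(x_2)-2s'(\{x_1,x_2\}),$$ $$d_b(x_1,x_2)=\max\{s(x_1),s(x_2)\}-s'(\{x_1,x_2\}),$$ $$d_c(x_1,x_2)=\begin{cases}0,&\text{if } s(x_1)=s(x_2)=0,\\ 1-\dfrac{s'(\{x_1,x_2\})}{\max\{s(x_1),s(x_2)\}},&\text{otherwise},\end{cases}$$ $$d_d(x_1,x_2)=\begin{cases}0,&\text{if } s(x_1)=s(x_2)=0,\\ 1-\dfrac{s'(\{x_1,x_2\})}{s(x_1)+s(x_2)-s'(\{x_1,x_2\})},&\text{otherwise}.\end{cases}$$ Then each of $d_a,d_b,d_c,d_d$ is a metric on $X$.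
   Context: A metric on $X$ is $d:X\times X\to[0,\infty)$ with $d(x,x)=0$, symmetry, the triangle inequality, and $d(x_1,x_2)=0\Rightarrow x_1=x_2$. For a partial order $\preccurlyeq$ on a set $X$ and $X'\subseteq X$, $cs(X')=\{x\in X: x\preccurlyeq y \text{ for all } y\in X'\}$. A size function on $(X,\preccurlyeq)$ is $s:X\to[0,\infty)$ with (S1) $x_1\preccurlyeq x_2\Rightarrow s(x_1)\le s(x_2)$ and (S2) $x_1\preccurlyeq x_2$ and $s(x_1)=s(x_2)$ $\Rightarrow x_1=x_2$. An MCS Model is a triple $(X,\preccurlyeq,s)$ with $\preccurlyeq$ a partial order on $X$, $s$ a size function, and (A1) for all $x_1,x_2\in X$, $cs(\{x_1,x_2\})\ne\emptyset$ and $\{s(x)\mid x\in cs(\{x_1,x_2\})\}$ has a maximum; (A2) for all $x_1,x_2,x\in X$ with $x_1,x_2\preccurlyeq x$ there is $x_{12}\in cs(\{x_1,x_2\})$ with $s(x)\ge s(x_1)+s(x_2)-s(x_{12})$. For $x_1,x_2\in X$, $s'(\{x_1,x_2\})=\max\{s(x): x\in cs(\{x_1,x_2\})\}$. *)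

(* Defs.v *)
From mathcomp Require Import all_boot all_order all_algebra.
From mathcomp Require Import classical_sets reals.

Set Implicit Arguments.
Unset Strict Implicit.
Unset Printing Implicit Defensive.

Import Order.TTheory GRing.Theory Num.Theory.
Local Open Scope classical_set_scope.
Local Open Scope ring_scope.

(* A proposition about a bare distance function: four distances on one type are
   compared, so the library's structure `metricType`, which attaches a single
   distance and its topology to the type, is not used. *)
Record is_metric (R : realType) (X : Type) (d : X -> X -> R) : Prop := IsMetric {
  metric_ge0 : forall x1 x2, 0 <= d x1 x2;
  metric_refl : forall x, d x x = 0;
  metric_sym : forall x1 x2, d x1 x2 = d x2 x1;
  metric_triangle : forall x1 x2 x3, d x1 x3 <= d x1 x2 + d x2 x3;
  metric_sep : forall x1 x2, d x1 x2 = 0 -> x1 = x2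
}.

(* The set of maxima of A: empty, or the singleton of the maximum. *)
Definition maximums (R : realType) (A : set R) : set R := A `&` ubound A.

(* The junk value 0 is taken when A has no maximum. *)
Definition maximum (R : realType) (A : set R) : R := xget 0 (maximums A).

Record is_size_function (disp : Order.disp_t) (X : porderType disp)
    (R : realType) (s : X -> R) : Prop := IsSizeFunction {
  size_ge0 : forall x, 0 <= s x;
  size_mono : forall x1 x2, (x1 <= x2)%O -> s x1 <= s x2;
  size_strict : forall x1 x2, (x1 <= x2)%O -> s x1 = s x2 -> x1 = x2
}.

(* The set cs(A) of common subelements of A is its set of lower bounds. *)
Definition cs (disp : Order.disp_t) (X : porderType disp) (A : set X) : set X :=
  lbound A.

Record is_MCS_model (disp : Order.disp_t) (X : porderType disp)
    (R : realType) (s : X -> R) : Prop := IsMCSModel {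
  MCS_size : is_size_function s;
  MCS_max : forall x1 x2, cs [set x1; x2] !=set0 /\
    maximums (s @` cs [set x1; x2]) !=set0;
  MCS_overlap : forall x1 x2 x, (x1 <= x)%O -> (x2 <= x)%O ->
    exists2 x12, cs [set x1; x2] x12 & s x >= s x1 + s x2 - s x12
}.

Section Distances.
Context (disp : Order.disp_t) (X : porderType disp) (R : realType).
Variable s : X -> R.

(* The size s'(A) of a maximum common subelement of A. *)
Definition mcs_size (A : set X) : R := maximum (s @` cs A).

Definition d_a (x1 x2 : X) : R :=
  s x1 + s x2 - 2 * mcs_size [set x1; x2].

Definition d_b (x1 x2 : X) : R :=
  Num.max (s x1) (s x2) - mcs_size [set x1; x2].

Definition d_c (x1 x2 : X) : R :=
  if (s x1 == 0) && (s x2 == 0) then 0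
  else 1 - mcs_size [set x1; x2] / Num.max (s x1) (s x2).

Definition d_d (x1 x2 : X) : R :=
  if (s x1 == 0) && (s x2 == 0) then 0
  else 1 - mcs_size [set x1; x2] / (s x1 + s x2 - mcs_size [set x1; x2]).

End Distances.

(* Main.v *)
(** A maximum common subelement of [x1, x2] and one of [x2, x3] both lie below
    [x2], so by (A2) they have a common subelement, which lies below [x1] and
    [x3].  Hence, writing [m x y] for [s'({x, y})],
      [m x1 x2 + m x2 x3 <= s x2 + m x1 x3].
    Each triangle inequality follows from this one by real arithmetic; for the
    ratio distances only the case [s x2 > 0] is not immediate. *)
Require Import Defs.
From mathcomp Require Import all_boot all_order all_algebra.
From mathcomp Require Import classical_sets reals.
From mathcomp Require Import ring lra.

Set Implicit Arguments.
Unset Strict Implicit.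
Unset Printing Implicit Defensive.

Import Order.TTheory GRing.Theory Num.Theory.
Local Open Scope classical_set_scope.
Local Open Scope ring_scope.

(** * Real inequalities behind the two ratio distances *)

Section RatioInequalities.
Context (R : realFieldType).
Implicit Types a b c p q r : R.

Lemma max_ratio_triangle_le a b c p q r :
  a <= c -> 0 < b -> 0 < c -> 0 <= r -> p <= b -> p + q <= b + r ->
  p / Num.max a b + q / Num.max b c <= 1 + r / Num.max a c.
Proof.
move=> leac b0 c0 r0 pb pqr; rewrite (max_r leac).
have [ltcb|lebc] := ltP c b.
  (* The left side has the single denominator [b], and [r / b <= r / c]. *)
  rewrite max_r ?(le_trans leac (ltW ltcb)) // -mulrDl.
  have rbc : r / b <= r / c by rewrite ler_wpM2l // lef_pV2 ?posrE ?ltW.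
  have : (p + q) / b <= (b + r) / b by rewrite ler_pM2r ?invr_gt0.
  by rewrite (mulrDl b) divff ?gt_eqF //; lra.
(* Write [p / u + q / c] as [p * (u^-1 - c^-1) + (p + q) / c]. Since [u <= c], the first coefficient
   is nonnegative, so [p] may be raised to [b] there. *)
set u := Num.max a b.
have leub : b <= u by rewrite le_max lexx orbT.
have u0 : 0 < u by apply: lt_le_trans leub.
have leuc : u <= c by rewrite ge_max leac lebc.
have H1 : p * (u^-1 - c^-1) <= b * (u^-1 - c^-1).
  by rewrite ler_wpM2r // subr_ge0 lef_pV2 ?posrE.
have H2 : b / u <= 1 by rewrite ler_pdivrMr ?mul1r.
have : (p + q) / c <= (b + r) / c by rewrite ler_pM2r ?invr_gt0.
by rewrite !mulrDl; lra.
Qed.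

(** Exchanging [(a, p)] with [(c, q)] preserves the inequality, which reduces it to [a <= c]. *)
Lemma max_ratio_triangle a b c p q r :
  0 < b -> 0 < Num.max a c -> 0 <= r -> p <= b -> q <= b -> p + q <= b + r ->
  p / Num.max a b + q / Num.max b c <= 1 + r / Num.max a c.
Proof.
move=> b0 ac0 r0 pb qb pqr; have [leac|ltca] := leP a c.
  rewrite -[X in r / X](max_r leac); apply: max_ratio_triangle_le => //.
  by rewrite -(max_r leac).
rewrite -[X in r / X](max_r (ltW ltca)) addrC (maxC b) (maxC a).
apply: max_ratio_triangle_le; rewrite ?(ltW ltca) 1?addrC //.
by rewrite -(max_l (ltW ltca)).
Qed.

(** For finite sets of sizes [a], [b], [c] with intersections of sizes [p], [q], [r], this is the
    triangle inequality of the Jaccard distance. *)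
Lemma union_ratio_triangle a b c p q r :
  0 < b -> 0 < a + c - r -> 0 <= a -> 0 <= c -> p <= a -> p <= b -> q <= b ->
  q <= c -> p + q <= b + r ->
  p / (a + b - p) + q / (b + c - q) <= 1 + r / (a + c - r).
Proof.
move=> b0 w0 a0 c0 pa pb qb qc pqr.
(* In the picture of sets, [x] and [z] count the elements of the outer sets that lie outside the
   middle one; [t] is the least [r] that [pqr] allows. *)
set x := a - p; set z := c - q; set t := p + q - b.
have x0 : 0 <= x by rewrite subr_ge0.
have z0 : 0 <= z by rewrite subr_ge0.
have -> : a + b - p = b + x by rewrite /x; ring.
have -> : b + c - q = b + z by rewrite /z; ring.
have bx0 : 0 < b + x by lra.
have bz0 : 0 < b + z by lra.
have bxz0 : 0 < b + x + z by lra.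
(* [v / (a + c - v)] increases with [v], so [r] may be lowered to [t], which
   turns the denominator into [b + x + z]. *)
have tr : t / (b + x + z) <= r / (a + c - r).
  rewrite ler_pdivrMr // mulrAC ler_pdivlMr // -subr_ge0.
  have -> : r * (b + x + z) - t * (a + c - r) = (a + c) * (r - t).
    by rewrite /x /z /t; ring.
  by apply: mulr_ge0; rewrite /t; lra.
apply: (@le_trans _ _ (1 + t / (b + x + z))); last by rewrite lerD2l.
have ix : (b + x + z)^-1 <= (b + x)^-1 by rewrite lef_pV2 ?posrE //; lra.
have iz : (b + x + z)^-1 <= (b + z)^-1 by rewrite lef_pV2 ?posrE //; lra.
(* The difference of the two sides is monotone in [p] and [q]: the extreme case
   is [p = q = b]. *)
have Hp : (p - b) / (b + x) <= (p - b) / (b + x + z).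
  by rewrite ler_wnM2l // subr_le0.
have Hq : (q - b) / (b + z) <= (q - b) / (b + x + z).
  by rewrite ler_wnM2l // subr_le0.
have Hb : b / (b + x) + b / (b + z) <= 1 + b / (b + x + z).
  rewrite -subr_ge0.
  have -> : 1 + b / (b + x + z) - (b / (b + x) + b / (b + z)) =
      x * z * (2 * b + x + z) / ((b + x) * (b + z) * (b + x + z)).
    by field; rewrite !gt_eqF.
  by rewrite divr_ge0 ?mulr_ge0 ?(ltW bx0) ?(ltW bz0) ?(ltW bxz0) //; lra.
move: Hp Hq Hb; rewrite /t !mulrDl !mulNr; lra.
Qed.

End RatioInequalities.

(** * Maximum common subelements, and the metrics [d_a] and [d_b] *)

Section MCSModel.
Context (disp : Order.disp_t) (X : porderType disp) (R : realType).
Variable s : X -> R.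
Hypothesis hs : is_MCS_model s.
Let m x1 x2 := mcs_size s [set x1; x2].
Let s_ge0 := size_ge0 (MCS_size hs).
Let s_mono := size_mono (MCS_size hs).

Lemma cs_set2P (x1 x2 x : X) :
  cs [set x1; x2] x <-> (x <= x1)%O /\ (x <= x2)%O.
Proof.
split=> [h|[h1 h2] y [->|->] //].
by split; apply: h; [left|right].
Qed.

Lemma mcs_size_maximums x1 x2 : maximums (s @` cs [set x1; x2]) (m x1 x2).
Proof. by have [_ [v hv]] := MCS_max hs x1 x2; apply: xgetPex; exists v. Qed.

Lemma mcs_size_attained x1 x2 :
  exists y, [/\ (y <= x1)%O, (y <= x2)%O & s y = m x1 x2].
Proof.
by have [[y /cs_set2P[h1 h2] e] _] := mcs_size_maximums x1 x2; exists y.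
Qed.

Lemma mcs_size_ub x1 x2 y : (y <= x1)%O -> (y <= x2)%O -> s y <= m x1 x2.
Proof.
move=> h1 h2; have [_ ub] := mcs_size_maximums x1 x2.
by apply: ub; exists y => //; apply/cs_set2P.
Qed.

Lemma mcs_sizeC x1 x2 : m x1 x2 = m x2 x1.
Proof. by rewrite /m setUC. Qed.

Lemma mcs_size_ge0 x1 x2 : 0 <= m x1 x2.
Proof. by have [y [_ _ <-]] := mcs_size_attained x1 x2. Qed.

Lemma mcs_size_lel x1 x2 : m x1 x2 <= s x1.
Proof. by have [y [h1 _ <-]] := mcs_size_attained x1 x2; apply: s_mono. Qed.

Lemma mcs_size_ler x1 x2 : m x1 x2 <= s x2.
Proof. by rewrite mcs_sizeC mcs_size_lel. Qed.

Lemma mcs_size_diag x : m x x = s x.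
Proof. by apply/eqP; rewrite eq_le mcs_size_lel mcs_size_ub. Qed.

(** A maximum common subelement then has the size of both elements, so (S2) identifies it with
    each. *)
Lemma mcs_size_sep x1 x2 : s x1 <= m x1 x2 -> s x2 <= m x1 x2 -> x1 = x2.
Proof.
move=> l1 l2; have [y [h1 h2 e]] := mcs_size_attained x1 x2.
have strict := size_strict (MCS_size hs).
have <- : y = x1.
  by apply: strict => //; apply/eqP; rewrite eq_le s_mono // e l1.
by apply: strict => //; apply/eqP; rewrite eq_le s_mono // e l2.
Qed.

Lemma mcs_size_triangle x1 x2 x3 : m x1 x2 + m x2 x3 <= s x2 + m x1 x3.
Proof.
have [y [y1 y2 <-]] := mcs_size_attained x1 x2.
have [z [z2 z3 <-]] := mcs_size_attained x2 x3.
have [w /cs_set2P[wy wz] le_w] := MCS_overlap hs y2 z2.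
have := mcs_size_ub (le_trans wy y1) (le_trans wz z3).
by move: le_w; lra.
Qed.

Lemma d_a_metric : is_metric (d_a s).
Proof.
split=> [x1 x2|x|x1 x2|x1 x2 x3|x1 x2]; rewrite /d_a -!/(m _ _).
- by have := mcs_size_lel x1 x2; have := mcs_size_ler x1 x2; lra.
- by rewrite mcs_size_diag; ring.
- by rewrite mcs_sizeC (addrC (s x1)).
- by have := mcs_size_triangle x1 x2 x3; lra.
(* [d_a] is the sum of the nonnegative numbers [s x1 - m x1 x2] and [s x2 - m x1 x2], so both
   vanish. *)
- have := mcs_size_lel x1 x2; have := mcs_size_ler x1 x2 => h2 h1 e.
  by apply: mcs_size_sep; lra.
Qed.

Lemma mcs_size_le_max x1 x2 : m x1 x2 <= Num.max (s x1) (s x2).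
Proof. by rewrite le_max mcs_size_lel. Qed.

Lemma d_b_metric : is_metric (d_b s).
Proof.
split=> [x1 x2|x|x1 x2|x1 x2 x3|x1 x2]; rewrite /d_b -!/(m _ _).
- by rewrite subr_ge0 mcs_size_le_max.
- by rewrite mcs_size_diag maxxx subrr.
- by rewrite mcs_sizeC maxC.
- have h := mcs_size_triangle x1 x2 x3.
  have hmax : Num.max (s x1) (s x3) + s x2 <=
      Num.max (s x1) (s x2) + Num.max (s x2) (s x3).
    have l1 : s x1 <= Num.max (s x1) (s x2) by rewrite le_max lexx.
    have l2 : s x2 <= Num.max (s x1) (s x2) by rewrite le_max lexx orbT.
    have l3 : s x2 <= Num.max (s x2) (s x3) by rewrite le_max lexx.
    have l4 : s x3 <= Num.max (s x2) (s x3) by rewrite le_max lexx orbT.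
    by rewrite -lerBrDr ge_max; apply/andP; split; lra.
  by move: h hmax; lra.
- by move/subr0_eq => e; apply: mcs_size_sep; rewrite -e le_max lexx ?orbT.
Qed.

(** Common form of [d_c] and [d_d], which are convertible to instances of it; only the triangle
    inequality for the weight [w] needs a separate argument in each case. *)
Definition ratio_dist (w : X -> X -> R) (x1 x2 : X) : R :=
  if (s x1 == 0) && (s x2 == 0) then 0
  else 1 - mcs_size s [set x1; x2] / w x1 x2.

Section RatioDistance.
Variable w : X -> X -> R.
Hypothesis wC : forall x1 x2, w x1 x2 = w x2 x1.
Hypothesis w_diag : forall x, w x x = s x.
Hypothesis w_ge : forall x1 x2, s x1 <= w x1 x2.
Hypothesis w_triangle : forall x1 x2 x3, 0 < s x2 -> 0 < w x1 x3 ->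
  m x1 x2 / w x1 x2 + m x2 x3 / w x2 x3 <= 1 + m x1 x3 / w x1 x3.

Let w_ger x1 x2 : s x2 <= w x1 x2. Proof. by rewrite wC. Qed.

Lemma ratio_weight_gt0 x1 x2 : ~~ ((s x1 == 0) && (s x2 == 0)) -> 0 < w x1 x2.
Proof.
rewrite negb_and => /orP[n0|n0].
- by apply: lt_le_trans (w_ge x1 x2); rewrite lt_def n0 s_ge0.
- by apply: lt_le_trans (w_ger x1 x2); rewrite lt_def n0 s_ge0.
Qed.

Lemma ratio_dist_ge0 x1 x2 : 0 <= ratio_dist w x1 x2.
Proof.
rewrite /ratio_dist -/(m _ _); case: ifPn => // /ratio_weight_gt0 w0.
rewrite subr_ge0 ler_pdivrMr // mul1r.
exact: le_trans (mcs_size_lel x1 x2) (w_ge x1 x2).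
Qed.

Lemma ratio_dist_le1 x1 x2 : ratio_dist w x1 x2 <= 1.
Proof.
rewrite /ratio_dist -/(m _ _); case: ifPn => // /ratio_weight_gt0 w0.
by rewrite gerBl divr_ge0 ?mcs_size_ge0 ?ltW.
Qed.

Lemma ratio_distC x1 x2 : ratio_dist w x1 x2 = ratio_dist w x2 x1.
Proof. by rewrite /ratio_dist -!/(m _ _) andbC mcs_sizeC wC. Qed.

Lemma ratio_dist_eq1 x1 x2 : s x1 = 0 -> s x2 != 0 -> ratio_dist w x1 x2 = 1.
Proof.
move=> e1 n2; rewrite /ratio_dist -/(m _ _) (negbTE n2) andbF.
suff -> : m x1 x2 = 0 by rewrite mul0r subr0.
by apply/eqP; rewrite eq_le mcs_size_ge0 -e1 mcs_size_lel.
Qed.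

Lemma ratio_dist_triangle x1 x2 x3 :
  ratio_dist w x1 x3 <= ratio_dist w x1 x2 + ratio_dist w x2 x3.
Proof.
have [s2|n2] := eqVneq (s x2) 0; last first.
  have s2 : 0 < s x2 by rewrite lt_def n2 s_ge0.
  rewrite {1}/ratio_dist -/(m _ _); case: ifPn => [_|/ratio_weight_gt0 w0].
    by rewrite addr_ge0 ?ratio_dist_ge0.
  rewrite /ratio_dist -!/(m _ _) (negbTE n2) andbF /=.
  by have := w_triangle s2 w0; lra.
(* When [s x2 = 0], an endpoint of nonzero size is at distance 1 from [x2], the largest possible
   value; if both endpoints have size 0, the left side is 0. *)
have [s1|n1] := eqVneq (s x1) 0; last first.
  rewrite (ratio_distC x1 x2) (ratio_dist_eq1 s2 n1).
  by have := ratio_dist_le1 x1 x3; have := ratio_dist_ge0 x2 x3; lra.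
have [s3|n3] := eqVneq (s x3) 0; last first.
  rewrite (ratio_dist_eq1 s2 n3).
  by have := ratio_dist_le1 x1 x3; have := ratio_dist_ge0 x1 x2; lra.
by rewrite {1}/ratio_dist s1 s3 eqxx addr_ge0 ?ratio_dist_ge0.
Qed.

(** Outside the case of two zero sizes, [m x1 x2] equals the weight, which dominates both sizes. *)
Lemma ratio_dist_sep x1 x2 : ratio_dist w x1 x2 = 0 -> x1 = x2.
Proof.
rewrite /ratio_dist -/(m _ _); case: ifPn => [/andP[/eqP e1 /eqP e2] _|].
  by apply: mcs_size_sep; rewrite ?e1 ?e2 mcs_size_ge0.
move=> /ratio_weight_gt0 w0 /subr0_eq/esym/divr1_eq e.
by apply: mcs_size_sep; rewrite e.
Qed.

Lemma ratio_dist_metric : is_metric (ratio_dist w).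
Proof.
split.
- exact: ratio_dist_ge0.
- move=> x; rewrite /ratio_dist -/(m _ _) andbb.
  by case: ifPn => // n0; rewrite mcs_size_diag w_diag divff // subrr.
- exact: ratio_distC.
- exact: ratio_dist_triangle.
- exact: ratio_dist_sep.
Qed.

End RatioDistance.

(** * The metrics [d_c] and [d_d] *)

Lemma d_c_metric : is_metric (d_c s).
Proof.
apply: (@ratio_dist_metric (fun x1 x2 => Num.max (s x1) (s x2))).
- by move=> x1 x2; rewrite maxC.
- by move=> x; rewrite maxxx.
- by move=> x1 x2; rewrite le_max lexx.
- move=> x1 x2 x3 s2 w0; apply: max_ratio_triangle => //.
  + exact: mcs_size_ge0.
  + exact: mcs_size_ler.
  + exact: mcs_size_lel.
  + exact: mcs_size_triangle.
Qed.

Lemma d_d_metric : is_metric (d_d s).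
Proof.
apply: (@ratio_dist_metric (fun x1 x2 => s x1 + s x2 - m x1 x2)).
- by move=> x1 x2; rewrite mcs_sizeC (addrC (s x1)).
- by move=> x; rewrite mcs_size_diag addrK.
- by move=> x1 x2; have := mcs_size_ler x1 x2; lra.
- move=> x1 x2 x3 s2 w0; apply: union_ratio_triangle;
    rewrite ?mcs_size_lel ?mcs_size_ler //.
  exact: mcs_size_triangle.
Qed.

End MCSModel.

Theorem theorem1 (disp : Order.disp_t) (X : porderType disp) (R : realType)
    (s : X -> R) (hs : is_MCS_model s) :
  [/\ is_metric (d_a s), is_metric (d_b s), is_metric (d_c s)
    & is_metric (d_d s)].
Proof.
split; [exact: d_a_metric|exact: d_b_metric|exact: d_c_metric|].
exact: d_d_metric.
Qed.
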